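(* Let $m,\alpha$ be positive integers. (a) Let $F\in \mathrm{Char}[\mathrm{B}_m,\mathrm{B}_\alpha]$ send $\mathrm{B}_m$ into a boundary component $C\subset\overline{\mathrm{B}}_\alpha$. Then $F\in \mathrm{Char}_\circ[\mathrm{B}_m,C]$. (b) Let $F\in \mathrm{Char}[\mathrm{B}_m,\mathrm{B}_\alpha]$ be the characteristic function of a matrix $\begin{pmatrix}a&b\\c&d\end{pmatrix}\in \mathrm{U}(\alpha+mj)$. Let $C\subset\overline{\mathrm{B}}_m$ be a boundary component, and suppose that $\det\bigl(1_{mj}-d\,(1_j\otimes S_0)\bigr)\ne 0$ for some $S_0\in C$. Then the restriction of $F$ to $C$ belongs to $\mathrm{Char}[C,\mathrm{B}_\alpha]$.
   Context: $\mathrm{U}(n)$ is the group of unitary $n\times n$ matrices and $1_n$ the unit matrix of order $n$. $\mathrm{B}_n$ is the set of complex $n\times n$ matrices $z$ with Euclidean operator norm $\|z\|<1$, and $\overline{\mathrm{B}}_n$ is the set of those with $\|z\|\le 1$; $\mathrm{B}_0$ is a single point. Characteristic functions: for an integer $j\ge 0$, let $g=\begin{pmatrix}a&b\\c&d\end{pmatrix}\in \mathrm{U}(\alpha+mj)$, with $a$ of size $\alpha\times\alpha$ and $d$ of size $mj\times mj$. For an $m\times m$ matrix $S=(s_{\mu\nu})$ let $1_j\otimes S$ denote the $mj\times mj$ block matrix with $m\times m$ blocks, whose $(\mu,\nu)$ block is $s_{\mu\nu}1_j$. The characteristic function of $g$ is $$\Theta[g;S]=a+b\,(1_j\otimes S)\bigl(1_{mj}-d\,(1_j\otimes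 S)\bigr)^{-1}c .$$ It is defined on $\mathrm{B}_m$ with values in $\overline{\mathrm{B}}_\alpha$; the same rational formula is used at points $S\in\overline{\mathrm{B}}_m$ with $\det(1_{mj}-d(1_j\otimes S))\neq0$. $\mathrm{Char}(m,\alpha)=\mathrm{Char}[\mathrm{B}_m,\mathrm{B}_\alpha]$ is the set of all functions $S\mapsto\Theta[g;S]$, where $g\in \mathrm{U}(\alpha+mj)$ and $j=0,1,2,\dots$. $\mathrm{Char}_\circ(m,\alpha)=\mathrm{Char}_\circ[\mathrm{B}_m,\mathrm{B}_\alpha]$ is the subset of those functions that send $\mathrm{B}_m$ into the open ball $\mathrm{B}_\alpha$. For $m=0$ the functions in $\mathrm{Char}(0,\alpha)$ are the constants $a\in\mathrm{U}(\alpha)$; for $\alpha=0$, $\mathrm{Char}(m,0)=\mathrm{Char}_\circ(m,0)$ consists of the unique map to the point $\mathrm{B}_0$. Linear fractional maps: $\mathrm{U}(n,n)$ is the group of complex block matrices $h=\begin{pmatrix}A&B\\C&D\end{pmatrix}$ of size $n+n$ with $h\begin{pmatrix}-1_n&0\\0&1_n\end{pmatrix}h^*=\begin{pmatrix}-1_n&0\\0&1_n\end{pmatrix}$. It acts on $\overline{\mathrm{B}}_n$ by $\gamma[h;z]=(A+zC)^{-1}(B+zD)$, preserving $\mathrm{B}_n$. Boundary components: the boundary $\partial\mathrm{B}_n=\{z:\|z\|=1\}$ is a disjoint union of boundary components, the maximal complex manifolds contained in it. Each boundary component has the form $$C=\Bigl\{\gamma\Bigl[h;\begin{pmatrix}u&0\\0&1_k\end{pmatrix}\Bigr]:\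 u\in \mathrm{B}_{n-k}\Bigr\}$$ for some $k\in\{1,\dots,n\}$ and $h\in\mathrm{U}(n,n)$. The map $\iota:u\mapsto\gamma\bigl[h;\begin{pmatrix}u&0\\0&1_k\end{pmatrix}\bigr]$ is a biholomorphic identification $\mathrm{B}_{n-k}\simeq C$, and $C$ is treated as a matrix ball $\mathrm{B}_{n-k}$ via such an identification. Thus, for $C\subset\partial\mathrm{B}_\alpha$, $F\in\mathrm{Char}_\circ[\mathrm{B}_m,C]$ means $F=\iota\circ\Phi$ with $\Phi\in\mathrm{Char}_\circ(m,\alpha-k)$. For $C\subset\partial\mathrm{B}_m$, the statement that the restriction of $F$ to $C$ belongs to $\mathrm{Char}[C,\mathrm{B}_\alpha]$ means that $F\circ\iota\in\mathrm{Char}(m-k,\alpha)$. *)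

(* Defs.v *)
From HB Require Import structures.
From mathcomp Require Import all_boot all_order all_algebra.
From mathcomp Require Import sesquilinear spectral.
From mathcomp Require Import classical_sets reals.
From mathcomp Require Import complex mxtens.

Set Implicit Arguments.
Unset Strict Implicit.
Unset Printing Implicit Defensive.

Import Order.TTheory GRing.Theory Num.Theory.

#[global] Open Scope classical_set_scope.
#[global] Open Scope sesquilinear_scope.
#[global] Open Scope complex_scope.
#[global] Open Scope ring_scope.

Section MatrixBalls.
Variable R : realType.
Implicit Types m n k j alpha : nat.

Definition vec_norm n (v : 'cV[R[i]]_n) : R :=
  Num.sqrt (\sum_(i < n) Normc.normc (v i 0) ^+ 2).

Definition op_norm n (z : 'M[R[i]]_n) : R :=
  sup [set vec_norm (z *m v) | v in [set v | vec_norm v <= 1]].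

Definition mball n : set 'M[R[i]]_n := [set z | op_norm z < 1].

(* In the Kronecker convention of mxtens, the matrix whose (mu, nu) block is
   s_{mu nu} 1_j is S *t 1_j. *)
Definition ampl j m (S : 'M[R[i]]_m) : 'M[R[i]]_(m * j) := S *t 1%:M.

Definition theta_den alpha m j (g : 'M[R[i]]_(alpha + m * j))
    (S : 'M[R[i]]_m) : 'M[R[i]]_(m * j) :=
  1%:M - drsubmx g *m ampl j S.

(* The value is meaningful only where theta_den g S is invertible (on mball m
   this is automatic when g is unitary). *)
Definition theta alpha m j (g : 'M[R[i]]_(alpha + m * j))
    (S : 'M[R[i]]_m) : 'M[R[i]]_alpha :=
  ulsubmx g + ursubmx g *m ampl j S *m invmx (theta_den g S) *m dlsubmx g.

(* Functions on the ball are total functions on matrices, only their values on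
   mball m being relevant. *)
Definition Char m alpha (F : 'M[R[i]]_m -> 'M[R[i]]_alpha) : Prop :=
  exists j (g : 'M[R[i]]_(alpha + m * j)),
    g \is unitarymx /\ forall S, mball S -> F S = theta g S.

Definition Char_o m alpha (F : 'M[R[i]]_m -> 'M[R[i]]_alpha) : Prop :=
  Char F /\ forall S, mball S -> mball (F S).

Definition Jmx n : 'M[R[i]]_(n + n) := block_mx (- 1%:M) 0 0 1%:M.

Definition pseudo_unitary n (h : 'M[R[i]]_(n + n)) : Prop :=
  h *m Jmx n *m h ^t* = Jmx n.

Definition lfrac n (h : 'M[R[i]]_(n + n)) (z : 'M[R[i]]_n) : 'M[R[i]]_n :=
  invmx (ulsubmx h + z *m dlsubmx h) *m (ursubmx h + z *m drsubmx h).

Definition diag_one n k (kn : (k <= n)%N) (u : 'M[R[i]]_(n - k)) :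
    'M[R[i]]_n :=
  castmx (subnK kn, subnK kn) (block_mx u 0 0 1%:M).

Definition iota_comp n k (kn : (k <= n)%N) (h : 'M[R[i]]_(n + n))
    (u : 'M[R[i]]_(n - k)) : 'M[R[i]]_n :=
  lfrac h (diag_one kn u).

(* iota_comp kn h identifies mball (n - k) with the boundary component Co. *)
Definition comp_chart n (Co : set 'M[R[i]]_n) k (kn : (k <= n)%N)
    (h : 'M[R[i]]_(n + n)) : Prop :=
  [/\ (0 < k)%N, pseudo_unitary h & Co = [set iota_comp kn h u | u in @mball (n - k)]].

(* The maximal complex manifolds contained in the boundary of mball n, given by
   their classification up to the action of U(n,n). *)
Definition boundary_component n (Co : set 'M[R[i]]_n) : Prop :=
  exists k (kn : (k <= n)%N) h, comp_chart Co kn h.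

(* Charts of the same component are not unique; the two properties below are
   required for all of them. *)
Definition Char_o_into m alpha (Co : set 'M[R[i]]_alpha)
    (F : 'M[R[i]]_m -> 'M[R[i]]_alpha) : Prop :=
  forall k (kn : (k <= alpha)%N) h, comp_chart Co kn h ->
    exists Phi : 'M[R[i]]_m -> 'M[R[i]]_(alpha - k),
      Char_o Phi /\ forall S, mball S -> F S = iota_comp kn h (Phi S).

Definition Char_restr m alpha (Co : set 'M[R[i]]_m)
    (F : 'M[R[i]]_m -> 'M[R[i]]_alpha) : Prop :=
  forall k (kn : (k <= m)%N) h, comp_chart Co kn h ->
    Char (fun u : 'M[R[i]]_(m - k) => F (iota_comp kn h u)).

End MatrixBalls.

(* Main.v *)
Require Import Defs.
From mathcomp Require Import all_boot all_order all_algebra.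
From mathcomp Require Import sesquilinear spectral.
From mathcomp Require Import classical_sets reals.
From mathcomp Require Import complex mxtens.

Set Implicit Arguments.
Unset Strict Implicit.
Unset Printing Implicit Defensive.

Import Order.TTheory GRing.Theory Num.Theory.

(** A characteristic function is best read as a feedback loop.  With
    g = (a b; c d), the value y = Theta[g; S] x is characterised by the linear
    relation g (x; q) = (y; p) together with the feedback law
    q = (1_j (x) S) p (lemmas [lft_graph] and [lft_graph_ex]), and the
    denominator is invertible exactly when the loop with x = 0 forces p = 0
    ([lft_den_unitP]).  Unitarity of g says that the relation conserves
    |x|^2 + |q|^2 = |y|^2 + |p|^2.

    A linear fractional map becomes linear in this picture: for
    h = (A B; C D) in U(n,n), the law q = gamma[h; Z] p is equivalent to
    A q - B p = Z (D p - C q), and the substitution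
    (q, p) -> (A q - B p, D p - C q) preserves |q|^2 - |p|^2.  Hence changing
    one pair of ports of g by this substitution yields a relation which still
    conserves energy, that is, the graph of another unitary matrix
    ([unitary_port_change], [unitary_outer_port_change]).  Up to such a change
    every boundary component may be taken in the standard form
    diag(u, 1) with |u| < 1.

    For restriction to a component of the source, the identity block of
    diag(u, 1) imposes q2 = p2 on part of the ports.  This loop can be closed
    once and for all, independently of u, provided that 1 - d22 is
    invertible, and the result is again unitary ([lft1_unitary]).  If
    1 - d22 kills a vector v, then energy conservation makes (0; v) a loop of
    the whole system for every u simultaneously, so that the denominator
    vanishes on the entire component: this is why one good point S_0 is enough
    ([lft_extend_id]).

    For a function with values in a component of the target, the value
    Theta(0) = a already has the form diag(u, 1).  Orthonormality of
    the rows of a unitary matrix leaves no room for other entries, so that the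
    compression of g to the remaining ports is unitary, with
    characteristic function u ([lft_compress]).

    Points of the open ball enter only as strict contractions for the
    Euclidean norm ([mball_strict]), a property which survives S |-> 1_j (x) S
    ([amplify_strict_contraction]). *)

(** * Adjoints, Gram matrices and squared norms *)

Section HermitianAlgebra.
Variable C : numClosedFieldType.
Implicit Types m n r w : nat.

Lemma adjmxM m n r (A : 'M[C]_(m, n)) (B : 'M[C]_(n, r)) :
  (A *m B) ^t* = B ^t* *m A ^t*.
Proof. by rewrite trmx_mul map_mxM. Qed.

Lemma adjmx1 n : (1%:M : 'M[C]_n) ^t* = 1%:M.
Proof. by rewrite trmx1 map_mx1. Qed.

Lemma adjmx0 m n : (0 : 'M[C]_(m, n)) ^t* = 0.
Proof. by rewrite trmx0 map_mx0. Qed.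

Lemma adjmx_col m n w (A : 'M[C]_(m, w)) (B : 'M[C]_(n, w)) :
  (col_mx A B) ^t* = row_mx (A ^t*) (B ^t*).
Proof. by rewrite tr_col_mx map_row_mx. Qed.

Lemma adjmx_row m n w (A : 'M[C]_(w, m)) (B : 'M[C]_(w, n)) :
  (row_mx A B) ^t* = col_mx (A ^t*) (B ^t*).
Proof. by rewrite tr_row_mx map_col_mx. Qed.

Lemma adjmx_block m1 m2 n1 n2 (A : 'M[C]_(m1, n1)) (B : 'M[C]_(m1, n2))
    (D : 'M[C]_(m2, n1)) (E : 'M[C]_(m2, n2)) :
  (block_mx A B D E) ^t* = block_mx (A ^t*) (D ^t*) (B ^t*) (E ^t*).
Proof. by rewrite tr_block_mx map_block_mx. Qed.

Lemma gram_col m n w (A : 'M[C]_(m, w)) (B : 'M[C]_(n, w)) :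
  (col_mx A B) ^t* *m col_mx A B = A ^t* *m A + B ^t* *m B.
Proof. by rewrite adjmx_col mul_row_col. Qed.

Lemma gram_isometry m n w (U : 'M[C]_(m, n)) (X : 'M[C]_(n, w)) :
  U ^t* *m U = 1%:M -> (U *m X) ^t* *m (U *m X) = X ^t* *m X.
Proof. by move=> UU; rewrite adjmxM mulmxA -[_ *m _ *m U]mulmxA UU mulmx1. Qed.

Lemma unitary_isometry n (U : 'M[C]_n) :
  U \is unitarymx <-> U ^t* *m U = 1%:M.
Proof. by split=> [/unitarymxP/mulmx1C|/mulmx1C/unitarymxP]. Qed.

Definition sqn n (v : 'cV[C]_n) : C := \sum_i `|v i 0| ^+ 2.

Lemma gram_sqn n (v : 'cV[C]_n) : v ^t* *m v = (sqn v)%:M.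
Proof.
apply/matrixP=> i k; rewrite !ord1 !mxE eqxx mulr1n; apply: eq_bigr => l _.
by rewrite !mxE mulrC -normCK.
Qed.

Lemma sqn_ge0 n (v : 'cV[C]_n) : 0 <= sqn v.
Proof. by apply: sumr_ge0 => i _; rewrite exprn_ge0. Qed.

Lemma sqn_eq0 n (v : 'cV[C]_n) : (sqn v == 0) = (v == 0).
Proof.
apply/idP/eqP => [|->]; last first.
  by rewrite /sqn big1 // => i _; rewrite mxE normr0 expr0n.
rewrite psumr_eq0; last by move=> i _; rewrite exprn_ge0.
move=> /allP v0; apply/colP=> i; rewrite mxE; apply/eqP.
by have := v0 i (mem_index_enum _); rewrite /= sqrf_eq0 normr_eq0.
Qed.

(** Transfers identities between Gram matrices, which hold for all widths, to
    the ordered setting of squared norms of single columns. *)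
Lemma sqn_gram_inj m n (u : 'cV[C]_m) (v : 'cV[C]_n) :
  u ^t* *m u = v ^t* *m v -> sqn u = sqn v.
Proof. by rewrite !gram_sqn => /matrixP/(_ 0 0); rewrite !mxE eqxx !mulr1n. Qed.

Lemma sqn_col m n (u : 'cV[C]_m) (v : 'cV[C]_n) :
  sqn (col_mx u v) = sqn u + sqn v.
Proof.
rewrite /sqn big_split_ord /=; congr (_ + _); apply: eq_bigr => i _.
  by rewrite col_mxEu.
by rewrite col_mxEd.
Qed.

Lemma sqn_isometry m n (U : 'M[C]_(m, n)) (v : 'cV[C]_n) :
  U ^t* *m U = 1%:M -> sqn (U *m v) = sqn v.
Proof. by move=> UU; apply: sqn_gram_inj; rewrite gram_isometry. Qed.

Lemma gram_eq0 m w (X : 'M[C]_(m, w)) : X ^t* *m X = 0 -> X = 0.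
Proof.
move=> X0; apply/matrixP=> i k; rewrite mxE.
have /eqP: sqn (col k X) = 0.
  have /matrixP/(_ k k) := X0; rewrite !mxE => <-; apply: eq_bigr => l _.
  by rewrite !mxE mulrC -normCK.
by rewrite sqn_eq0 => /eqP/colP/(_ i); rewrite !mxE.
Qed.

Lemma unitmx_ker0 n (A : 'M[C]_n) :
  (forall v : 'cV[C]_n, A *m v = 0 -> v = 0) -> A \in unitmx.
Proof.
move=> A0; rewrite -unitmx_tr -row_free_unit; apply: inj_row_free => v vA.
apply: trmx_inj; rewrite trmx0; apply: A0.
by rewrite -[A]trmxK -trmx_mul vA trmx0.
Qed.

Definition contraction n (t : 'M[C]_n) :=
  forall v : 'cV[C]_n, sqn (t *m v) <= sqn v.

Definition strict_contraction n (t : 'M[C]_n) :=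
  forall v : 'cV[C]_n, v != 0 -> sqn (t *m v) < sqn v.

Lemma strict_contractionW n (t : 'M[C]_n) :
  strict_contraction t -> contraction t.
Proof.
move=> ts v; have [->|v0] := eqVneq v 0; first by rewrite mulmx0.
exact/ltW/ts.
Qed.

(** * Linear fractional transforms as feedback loops *)

(** The value at x of [lft g t] is the output y of the system
    (y; p) = g (x; q) closed by the feedback q = t p. *)
Definition lft n r (g : 'M[C]_(n + r)) (t : 'M[C]_r) : 'M[C]_n :=
  ulsubmx g + ursubmx g *m t *m invmx (1%:M - drsubmx g *m t) *m dlsubmx g.

Lemma mul_submx_col n r w (g : 'M[C]_(n + r)) (x : 'M[C]_(n, w))
    (q : 'M[C]_(r, w)) :
  g *m col_mx x q = col_mx (ulsubmx g *m x + ursubmx g *m q)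
                           (dlsubmx g *m x + drsubmx g *m q).
Proof. by rewrite -{1}[g]submxK mul_block_col. Qed.

Lemma lft_graph n r w (g : 'M[C]_(n + r)) (t : 'M[C]_r) (x y : 'M[C]_(n, w))
    (p : 'M[C]_(r, w)) :
  1%:M - drsubmx g *m t \in unitmx ->
  g *m col_mx x (t *m p) = col_mx y p -> y = lft g t *m x.
Proof.
move=> tu; rewrite mul_submx_col => /eq_col_mx [<- pE].
have {pE} -> : p = invmx (1%:M - drsubmx g *m t) *m (dlsubmx g *m x).
  apply/esym/(canLR (mulKmx tu)).
  by rewrite mulmxBl mul1mx -{1}pE mulmxA addrK.
by rewrite /lft mulmxDl !mulmxA.
Qed.

Lemma lft_graph_ex n r w (g : 'M[C]_(n + r)) (t : 'M[C]_r) (x : 'M[C]_(n, w)) :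
  1%:M - drsubmx g *m t \in unitmx ->
  exists p, g *m col_mx x (t *m p) = col_mx (lft g t *m x) p.
Proof.
move=> tu; exists (invmx (1%:M - drsubmx g *m t) *m (dlsubmx g *m x)).
rewrite mul_submx_col; congr col_mx; first by rewrite /lft mulmxDl !mulmxA.
set p := invmx _ *m _.
have : (1%:M - drsubmx g *m t) *m p = dlsubmx g *m x by rewrite mulKVmx.
by rewrite mulmxBl mul1mx mulmxA => <-; rewrite subrK.
Qed.

(** Well-posedness of the loop: without external input nothing circulates.
    In this form invertibility of the denominator is insensitive to changes of
    coordinates on the ports. *)
Lemma lft_den_unitP n r (g : 'M[C]_(n + r)) (t : 'M[C]_r) :
  1%:M - drsubmx g *m t \in unitmx <->
  (forall (y : 'cV[C]_n) p, g *m col_mx 0 (t *m p) = col_mx y p -> p = 0).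
Proof.
split=> [tu y p|H].
  rewrite mul_submx_col !mulmx0 !add0r => /eq_col_mx [_ pE].
  rewrite -[p](mulKmx tu) mulmxBl mul1mx -mulmxA pE subrr mulmx0 //.
apply: unitmx_ker0 => v; rewrite mulmxBl mul1mx => /eqP; rewrite subr_eq0.
move=> /eqP vE; apply: (H (ursubmx g *m (t *m v))).
by rewrite mul_submx_col !mulmx0 !add0r [_ *m (t *m v) in X in col_mx _ X]mulmxA -vE.
Qed.

(** A circulating signal p would satisfy |p| <= |t p| because g is isometric,
    while t strictly decreases the norm of p when p is nonzero. *)
Lemma lft_den_strict n r (g : 'M[C]_(n + r)) (t : 'M[C]_r) :
  g \is unitarymx -> strict_contraction t -> 1%:M - drsubmx g *m t \in unitmx.
Proof.
move=> /unitary_isometry gu ts; apply/lft_den_unitP => y p gE.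
apply/eqP; apply/negPn/negP => /ts; rewrite le_gtF //.
have := sqn_isometry (col_mx 0 (t *m p)) gu; rewrite gE !sqn_col.
have /eqP -> : sqn (0 : 'cV[C]_n) == 0 by rewrite sqn_eq0.
by rewrite add0r => <-; rewrite lerDr sqn_ge0.
Qed.

(** Under the feedback q = p the terms |q|^2 and |p|^2 in the energy balance
    of g cancel, leaving |x|^2 = |y|^2. *)
Lemma lft1_unitary n r (g : 'M[C]_(n + r)) :
  g \is unitarymx -> 1%:M - drsubmx g *m 1%:M \in unitmx ->
  lft g 1%:M \is unitarymx.
Proof.
move=> /unitary_isometry gu tu; apply/unitary_isometry.
have [p] := lft_graph_ex 1%:M tu; rewrite mul1mx mulmx1 => gE.
have := gram_isometry (col_mx 1%:M p) gu; rewrite gE !gram_col => /addIr.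
by rewrite adjmx1 mul1mx.
Qed.

(** * Pseudo-unitary changes of ports *)

Definition signature_mx n : 'M[C]_(n + n) := block_mx (- 1%:M) 0 0 1%:M.

Definition pseudo_unitarymx n (h : 'M[C]_(n + n)) :=
  h *m signature_mx n *m h ^t* = signature_mx n.

Lemma signature_mxK n : signature_mx n *m signature_mx n = 1%:M.
Proof.
rewrite /signature_mx mulmx_block !mulmx0 !mul0mx !addr0 !add0r mul1mx.
by rewrite mulNmx mulmxN opprK mul1mx -scalar_mx_block.
Qed.

Lemma pseudo_unitarymx_adj n (h : 'M[C]_(n + n)) :
  pseudo_unitarymx h -> h ^t* *m signature_mx n *m h = signature_mx n.
Proof.
move=> hJ; have /mulmx1C : h *m (signature_mx n *m h ^t* *m signature_mx n) = 1%:M.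
  by rewrite !mulmxA hJ signature_mxK.
move=> /(congr1 (mulmx (signature_mx n))).
rewrite -!mulmxA [signature_mx n *m (signature_mx n *m _)]mulmxA signature_mxK.
by rewrite mul1mx mulmx1.
Qed.

Lemma pseudo_unitarymx_unit n (h : 'M[C]_(n + n)) : pseudo_unitarymx h -> h \in unitmx.
Proof.
move=> hJ; have : h *m (signature_mx n *m h ^t* *m signature_mx n) = 1%:M.
  by rewrite !mulmxA hJ signature_mxK.
by case/mulmx1_unit.
Qed.

Lemma gram_signature_mx n w (u v : 'M[C]_(n, w)) :
  (col_mx u v) ^t* *m signature_mx n *m col_mx u v = v ^t* *m v - u ^t* *m u.
Proof.
rewrite adjmx_col -mulmxA /signature_mx mul_block_col !mul0mx addr0 add0r mul1mx mulNmx.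
by rewrite mul1mx mul_row_col mulmxN addrC.
Qed.

Lemma pseudo_unitarymx_gram n w (h : 'M[C]_(n + n)) (u v u' v' : 'M[C]_(n, w)) :
  pseudo_unitarymx h -> h *m col_mx u v = col_mx u' v' ->
  v' ^t* *m v' - u' ^t* *m u' = v ^t* *m v - u ^t* *m u.
Proof.
move=> /pseudo_unitarymx_adj hJ hE; rewrite -!gram_signature_mx -hE adjmxM.
by rewrite !mulmxA -[_ *m _ *m signature_mx n]mulmxA -[_ *m _ *m h]mulmxA hJ.
Qed.

(** The two functions [port_fst] and [port_snd] are the components of
    (q; p) |-> (A q - B p; D p - C q); the signs are those which turn
    q = gamma[h; z] p into a feedback law with matrix z
    (see [linfrac_graph]). *)
Definition port_fst n w (h : 'M[C]_(n + n)) (q p : 'M[C]_(n, w)) :=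
  ulsubmx h *m q - ursubmx h *m p.
Definition port_snd n w (h : 'M[C]_(n + n)) (q p : 'M[C]_(n, w)) :=
  drsubmx h *m p - dlsubmx h *m q.

(** Up to signs the change of ports is h itself, so that it is invertible and
    preserves the indefinite form. *)
Lemma mul_ports n w (h : 'M[C]_(n + n)) (q p : 'M[C]_(n, w)) :
  h *m col_mx q (- p) = col_mx (port_fst h q p) (- port_snd h q p).
Proof. by rewrite mul_submx_col !mulmxN /port_fst /port_snd opprB. Qed.

Lemma ports_inj n w (h : 'M[C]_(n + n)) (q p q' p' : 'M[C]_(n, w)) :
  pseudo_unitarymx h ->
  port_fst h q p = port_fst h q' p' -> port_snd h q p = port_snd h q' p' ->
  q = q' /\ p = p'.
Proof.
move=> /pseudo_unitarymx_unit hu e1 e2.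
have : col_mx q (- p) = col_mx q' (- p').
  by rewrite -[LHS](mulKmx hu) -[RHS](mulKmx hu) !mul_ports e1 e2.
by case/eq_col_mx => -> /oppr_inj ->.
Qed.

Lemma gramN m n (X : 'M[C]_(m, n)) : (- X) ^t* *m (- X) = X ^t* *m X.
Proof.
have -> : (- X) ^t* = - X ^t* by apply/matrixP=> i k; rewrite !mxE rmorphN.
by rewrite mulNmx mulmxN opprK.
Qed.

Lemma ports_gram n w (h : 'M[C]_(n + n)) (q p : 'M[C]_(n, w)) :
  pseudo_unitarymx h ->
  (port_fst h q p) ^t* *m port_fst h q p + p ^t* *m p =
  (port_snd h q p) ^t* *m port_snd h q p + q ^t* *m q.
Proof.
move=> hJ; have := pseudo_unitarymx_gram hJ (mul_ports h q p); rewrite !gramN => /eqP.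
by rewrite subr_eq addrAC eq_sym subr_eq addrC => /eqP ->; rewrite addrC.
Qed.

Lemma ports_surj n w (h : 'M[C]_(n + n))
    (q' p' : 'M[C]_(n, w)) :
  pseudo_unitarymx h -> exists q p, port_fst h q p = q' /\ port_snd h q p = p'.
Proof.
move=> /pseudo_unitarymx_unit hu; pose v := invmx h *m col_mx q' (- p').
exists (usubmx v), (- dsubmx v).
have := mul_ports h (usubmx v) (- dsubmx v); rewrite opprK vsubmxK mulKVmx //.
by case/eq_col_mx => <- /oppr_inj <-.
Qed.

(** The relation g (x; q) = (y; p) is parametrised by (x; q), and in the new
    ports the inputs are M (x; q) and the outputs N (x; q).  Invariance of
    |q|^2 - |p|^2 under h turns the energy balance of g into M* M = N* N.  A
    vector killed by M is then killed by N, hence all its ports vanish and it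
    is zero; so M is invertible and N M^-1 is the required unitary matrix. *)
Lemma unitary_port_change n r (g : 'M[C]_(n + r)) (h : 'M[C]_(r + r)) :
  g \is unitarymx -> pseudo_unitarymx h ->
  exists2 g' : 'M[C]_(n + r), g' \is unitarymx &
    forall w (x y : 'M[C]_(n, w)) (q p : 'M[C]_(r, w)),
      g *m col_mx x q = col_mx y p <->
      g' *m col_mx x (port_fst h q p) = col_mx y (port_snd h q p).
Proof.
move=> /unitary_isometry gu hJ.
(* P and Q read the ports p and q off the parameter (x; q). *)
pose P : 'M[C]_(r, n + r) := dsubmx g.
pose Q : 'M[C]_(r, n + r) := dsubmx 1%:M.
pose M := col_mx (usubmx (1%:M : 'M[C]_(n + r))) (port_fst h Q P).
pose N := col_mx (usubmx g) (port_snd h Q P).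
have actM w (v : 'M[C]_(n + r, w)) :
    M *m v = col_mx (usubmx v) (port_fst h (dsubmx v) (dsubmx (g *m v))).
  rewrite /M mul_col_mx /port_fst mulmxBl -!mulmxA !mul_dsub_mx mul_usub_mx.
  by rewrite mul1mx.
have actN w (v : 'M[C]_(n + r, w)) :
    N *m v = col_mx (usubmx (g *m v)) (port_snd h (dsubmx v) (dsubmx (g *m v))).
  rewrite /N mul_col_mx /port_snd mulmxBl -!mulmxA !mul_dsub_mx mul_usub_mx.
  by rewrite mul1mx.
have MN : M ^t* *m M = N ^t* *m N.
  apply: (@addIr _ (P ^t* *m P)).
  have in1 : (usubmx 1%:M) ^t* *m usubmx 1%:M + Q ^t* *m Q = 1%:M :> 'M_(n + r).
    by rewrite -gram_col vsubmxK adjmx1 mul1mx.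
  have out1 : (usubmx g) ^t* *m usubmx g + P ^t* *m P = 1%:M.
    by rewrite -gram_col vsubmxK.
  rewrite !gram_col -[LHS]addrA ports_gram // [X in _ + X]addrC addrA in1.
  by rewrite -out1 addrAC.
have Mu : M \in unitmx.
  apply: unitmx_ker0 => v Mv.
  have Nv : N *m v = 0.
    apply: gram_eq0; rewrite adjmxM mulmxA -[_ *m _ *m N]mulmxA -MN.
    by rewrite -!mulmxA Mv !mulmx0.
  move: Mv Nv; rewrite actM actN -[0]vsubmxK !linear0 => /eq_col_mx [v1 v2].
  move=> /eq_col_mx [_ v3].
  have [v0 _] : dsubmx v = 0 /\ dsubmx (g *m v) = 0.
    by apply: (ports_inj hJ); rewrite ?v2 ?v3 /port_fst /port_snd !mulmx0 subrr.
  by rewrite -[v]vsubmxK v1 v0 col_mx0.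
exists (N *m invmx M).
  apply/unitary_isometry; rewrite adjmxM mulmxA -[_ *m _ *m N]mulmxA -MN.
  rewrite -!mulmxA mulmxV // mulmx1 -adjmxM mulmxV // adjmx1 //.
have fwd w (v : 'M[C]_(n + r, w)) : N *m invmx M *m (M *m v) = N *m v.
  by rewrite mulmxA mulmxKV.
move=> w x y q p; split=> E.
  by have := actN _ (col_mx x q); rewrite -fwd actM E !(col_mxKu, col_mxKd).
set v := invmx M *m col_mx x (port_fst h q p).
have Mv : M *m v = col_mx x (port_fst h q p) by rewrite mulKVmx.
have Nv : N *m v = col_mx y (port_snd h q p) by rewrite -fwd Mv.
move: Mv Nv; rewrite actM actN => /eq_col_mx [v1 v2] /eq_col_mx [w1 w2].
have [v3 w3] := ports_inj hJ v2 w2.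
by rewrite -v1 -v3 vsubmxK -w1 -w3 vsubmxK.
Qed.

(** The adjoint of g with its blocks exchanged: it describes the same relation
    run backwards, and exchanges external and feedback ports. *)
Definition flip n r (g : 'M[C]_(n + r)) : 'M[C]_(r + n) :=
  block_mx ((drsubmx g) ^t*) ((ursubmx g) ^t*)
           ((dlsubmx g) ^t*) ((ulsubmx g) ^t*).

Lemma flip_unitary n r (g : 'M[C]_(n + r)) :
  g \is unitarymx -> flip g \is unitarymx.
Proof.
move=> /unitarymxP; rewrite -{1 2}[g]submxK adjmx_block mulmx_block.
rewrite scalar_mx_block => /eq_block_mx [aa ac ca cc].
apply/unitary_isometry; rewrite /flip adjmx_block !trmxCK mulmx_block.
rewrite scalar_mx_block ![ursubmx g *m _ + _]addrC ![drsubmx g *m _ + _]addrC.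
by rewrite aa ac ca cc.
Qed.

Lemma flip_graph n r w (g : 'M[C]_(n + r)) (x y : 'M[C]_(n, w))
    (q p : 'M[C]_(r, w)) : g \is unitarymx ->
  g *m col_mx x q = col_mx y p <-> flip g *m col_mx p y = col_mx q x.
Proof.
move=> gu; have gV : flip g *m col_mx p y = col_mx q x <->
    g ^t* *m col_mx y p = col_mx x q.
  rewrite -{2}[g]submxK adjmx_block !mul_block_col.
  by split=> /eq_col_mx [<- <-]; rewrite addrC [X in col_mx _ X]addrC.
rewrite gV; split=> [<-|<-]; rewrite mulmxA.
  by rewrite (unitary_isometry g).1 // mul1mx.
by rewrite (unitarymxP gu) mul1mx.
Qed.

(** The analogue of [unitary_port_change] for the external ports, obtained by
    running the system backwards; the output y takes the place of q and the
    input x that of p, since y = gamma[h; z] x is the law to be simplified. *)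
Lemma unitary_outer_port_change n r (g : 'M[C]_(n + r)) (h : 'M[C]_(n + n)) :
  g \is unitarymx -> pseudo_unitarymx h ->
  exists2 g' : 'M[C]_(n + r), g' \is unitarymx &
    forall w (x y : 'M[C]_(n, w)) (q p : 'M[C]_(r, w)),
      g *m col_mx x q = col_mx y p <->
      g' *m col_mx (port_snd h y x) q = col_mx (port_fst h y x) p.
Proof.
move=> gu hJ; have [f fu fE] := unitary_port_change (flip_unitary gu) hJ.
exists (flip f); first exact: flip_unitary.
by move=> w x y q p; rewrite (flip_graph _ _ _ _ gu) fE (flip_graph _ _ _ _ fu).
Qed.

(** * Linear fractional maps *)

Definition linfrac n (h : 'M[C]_(n + n)) (z : 'M[C]_n) : 'M[C]_n :=
  invmx (ulsubmx h + z *m dlsubmx h) *m (ursubmx h + z *m drsubmx h).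

(** If (A + z C) v = 0, then |A v| <= |C v|, whereas invariance of the
    indefinite form on (v; 0) gives |A v|^2 - |C v|^2 = |v|^2. *)
Lemma linfrac_den_unit n (h : 'M[C]_(n + n)) (z : 'M[C]_n) :
  pseudo_unitarymx h -> contraction z -> ulsubmx h + z *m dlsubmx h \in unitmx.
Proof.
move=> hJ zc; apply: unitmx_ker0 => v; rewrite mulmxDl -mulmxA => /eqP.
rewrite addr_eq0 => /eqP Av.
have := pseudo_unitarymx_gram hJ (mul_submx_col h v 0).
rewrite !mulmx0 !addr0 sub0r Av gramN !gram_sqn => /matrixP/(_ 0 0).
rewrite !mxE eqxx !mulr1n => E; apply/eqP; rewrite -sqn_eq0.
by rewrite eq_le sqn_ge0 -oppr_ge0 -E subr_ge0 zc.
Qed.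

Lemma linfrac_graph n w (h : 'M[C]_(n + n)) (z : 'M[C]_n) (q p : 'M[C]_(n, w)) :
  ulsubmx h + z *m dlsubmx h \in unitmx ->
  q = linfrac h z *m p <-> port_fst h q p = z *m port_snd h q p.
Proof.
move=> du; set A := _ + _ in du.
have -> : port_fst h q p = z *m port_snd h q p <->
    A *m q = (ursubmx h + z *m drsubmx h) *m p.
  have dE : port_fst h q p - z *m port_snd h q p =
      A *m q - (ursubmx h + z *m drsubmx h) *m p.
    by rewrite /port_fst /port_snd /A mulmxBr !mulmxDl -!mulmxA opprB addrACA -opprD.
  by split=> E; apply: subr0_eq; rewrite (dE, =^~ dE) E subrr.
rewrite /linfrac -/A -mulmxA; split=> [->|<-]; first by rewrite mulKVmx.
by rewrite mulKmx.
Qed.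

(** * Closing the loop on an identity block *)

(** E1 and E2 are isometric embeddings with complementary orthogonal ranges.
    Working with embeddings instead of block matrices avoids transporting the
    decomposition m = (m - k) + k through the index set of m * j. *)
Definition orth_split n n1 n2 (E1 : 'M[C]_(n, n1)) (E2 : 'M[C]_(n, n2)) :=
  [/\ E1 ^t* *m E1 = 1%:M, E2 ^t* *m E2 = 1%:M, E1 ^t* *m E2 = 0 &
      E1 *m E1 ^t* + E2 *m E2 ^t* = 1%:M].

(** The matrix diag(t, 1) in the decomposition given by E1 and E2. *)
Definition extend_id n n1 n2 (E1 : 'M[C]_(n, n1)) (E2 : 'M[C]_(n, n2))
    (t : 'M[C]_n1) : 'M[C]_n :=
  E1 *m t *m E1 ^t* + E2 *m E2 ^t*.

Section Split.
Variables (n n1 n2 : nat) (E1 : 'M[C]_(n, n1)) (E2 : 'M[C]_(n, n2)).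
Hypothesis sE : orth_split E1 E2.

Let e11 : E1 ^t* *m E1 = 1%:M. Proof. by case: sE. Qed.
Let e22 : E2 ^t* *m E2 = 1%:M. Proof. by case: sE. Qed.
Let e12 : E1 ^t* *m E2 = 0. Proof. by case: sE. Qed.
Let e21 : E2 ^t* *m E1 = 0.
Proof. by rewrite -[E1]trmxCK -adjmxM e12 adjmx0. Qed.
Let eD : E1 *m E1 ^t* + E2 *m E2 ^t* = 1%:M. Proof. by case: sE. Qed.

Lemma split_decomp w (v : 'M[C]_(n, w)) :
  v = E1 *m (E1 ^t* *m v) + E2 *m (E2 ^t* *m v).
Proof. by rewrite !mulmxA -mulmxDl eD mul1mx. Qed.

Lemma split_sqn (v : 'cV[C]_n) : sqn v = sqn (E1 ^t* *m v) + sqn (E2 ^t* *m v).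
Proof.
rewrite -sqn_col; apply: sqn_gram_inj.
rewrite gram_col !adjmxM !trmxCK !mulmxA -mulmxDl -!mulmxA -mulmxDr.
by rewrite eD mulmx1.
Qed.

Lemma extend_id_fst t : E1 ^t* *m extend_id E1 E2 t = t *m E1 ^t*.
Proof. by rewrite /extend_id mulmxDr !mulmxA e11 e12 mul1mx mul0mx addr0. Qed.

Lemma extend_id_snd t : E2 ^t* *m extend_id E1 E2 t = E2 ^t*.
Proof. by rewrite /extend_id mulmxDr !mulmxA e22 e21 !mul0mx mul1mx add0r. Qed.

Lemma extend_id_E2 t : extend_id E1 E2 t *m E2 = E2.
Proof. by rewrite /extend_id mulmxDl -!mulmxA e22 e12 !mulmx0 mulmx1 add0r. Qed.

Lemma extend_id_mul w t (v : 'M[C]_(n, w)) :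
  extend_id E1 E2 t *m v = E1 *m (t *m (E1 ^t* *m v)) + E2 *m (E2 ^t* *m v).
Proof. by rewrite /extend_id mulmxDl !mulmxA. Qed.

Lemma extend_id_contraction t : contraction t -> contraction (extend_id E1 E2 t).
Proof.
move=> tc v; rewrite split_sqn [leRHS]split_sqn.
by rewrite !mulmxA extend_id_fst extend_id_snd lerD2r -mulmxA tc.
Qed.

Lemma split_inj2 w (v : 'M[C]_(n2, w)) : E2 *m v = 0 -> v = 0.
Proof. by move=> v0; rewrite -[v]mul1mx -e22 -mulmxA v0 mulmx0. Qed.

(** Separates the feedback ports of g along the decomposition, keeping the
    second part outermost so that it can be closed first. *)
Lemma split_ports m (g : 'M[C]_(m + n)) : g \is unitarymx ->
  exists2 G : 'M[C]_((m + n1) + n2), G \is unitarymx &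
    forall w (x y : 'M[C]_(m, w)) q1 p1 q2 p2,
      G *m col_mx (col_mx x q1) q2 = col_mx (col_mx y p1) p2 <->
      g *m col_mx x (E1 *m q1 + E2 *m q2) = col_mx y (E1 *m p1 + E2 *m p2).
Proof.
move=> /unitary_isometry gu.
pose P : 'M[C]_(m + n, (m + n1) + n2) :=
  row_mx (block_mx 1%:M 0 0 E1) (col_mx 0 E2).
have PE w (x : 'M[C]_(m, w)) q1 q2 : P *m col_mx (col_mx x q1) q2 =
    col_mx x (E1 *m q1 + E2 *m q2).
  rewrite mul_row_col mul_block_col mul_col_mx add_col_mx.
  by rewrite !mul0mx mul1mx add0r !addr0.
have PP : P ^t* *m P = 1%:M.
  rewrite adjmx_row mul_col_row adjmx_block adjmx_col mulmx_block.
  rewrite mul_row_block mul_block_col mul_row_col !adjmx0 !adjmx1.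
  rewrite !(mul0mx, mulmx0, addr0, add0r) e11 e12 e21 e22 mulmx1.
  by rewrite -scalar_mx_block col_mx0 row_mx0 -scalar_mx_block.
have PPt : P *m P ^t* = 1%:M.
  rewrite adjmx_row mul_row_col adjmx_block adjmx_col mulmx_block mul_col_row.
  rewrite add_block_mx !adjmx0 !adjmx1.
  rewrite !(mul0mx, mulmx0, addr0, add0r) eD mulmx1.
  by rewrite -scalar_mx_block.
exists (P ^t* *m g *m P).
  apply/unitary_isometry; rewrite !adjmxM trmxCK !mulmxA.
  rewrite -[_ *m P *m P ^t*]mulmxA PPt mulmx1.
  by rewrite -[_ *m g ^t* *m g]mulmxA gu mulmx1 PP.
move=> w x y q1 p1 q2 p2; rewrite -!PE -!mulmxA; split=> [<-|->].
  by rewrite [RHS]mulmxA PPt mul1mx.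
by rewrite mulmxA PP mul1mx.
Qed.

(** The identity part of the feedback does not depend on t, so that it can be
    closed first.  Its well-posedness follows from that of the loop at the
    single matrix t0: a signal v circulating through the identity part alone
    has output 0 by conservation of energy, hence also circulates in the full
    loop, whatever t0 is. *)
Lemma lft_extend_id m (g : 'M[C]_(m + n)) t0 : g \is unitarymx ->
  1%:M - drsubmx g *m extend_id E1 E2 t0 \in unitmx ->
  exists2 g' : 'M[C]_(m + n1), g' \is unitarymx &
    forall t, strict_contraction t ->
      1%:M - drsubmx g *m extend_id E1 E2 t \in unitmx /\
      lft g (extend_id E1 E2 t) = lft g' t.
Proof.
move=> gu /lft_den_unitP u0; have [G Gu GE] := split_ports gu.
have Gd : 1%:M - drsubmx G *m 1%:M \in unitmx.
  apply/lft_den_unitP => Y v; rewrite mul1mx => E.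
  (* G maps (0; v) to (Y; v) isometrically. *)
  have Y0 : Y = 0.
    have := sqn_isometry (col_mx 0 v) ((unitary_isometry G).1 Gu).
    rewrite E !sqn_col => /addIr/eqP.
    by rewrite (eqP (_ : sqn 0 == 0)) sqn_eq0 // => /eqP.
  apply: split_inj2; apply: (u0 0); rewrite mulmxA extend_id_E2.
  move: E; rewrite Y0 -[0]vsubmxK !linear0 => /GE.
  by rewrite !mulmx0 !add0r.
have G1 := lft1_unitary Gu Gd.
(* A signal in the full loop is also a signal in the loop closed in two steps. *)
have trans w t (x y : 'M[C]_(m, w)) p :
    g *m col_mx x (extend_id E1 E2 t *m p) = col_mx y p ->
    G *m col_mx (col_mx x (t *m (E1 ^t* *m p))) (1%:M *m (E2 ^t* *m p)) =
    col_mx (col_mx y (E1 ^t* *m p)) (E2 ^t* *m p).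
  by move=> E; apply/GE; rewrite mul1mx -extend_id_mul -split_decomp.
exists (lft G 1%:M) => // t ts.
have td := lft_den_strict G1 ts.
have tu : 1%:M - drsubmx g *m extend_id E1 E2 t \in unitmx.
  apply/lft_den_unitP => y p /trans E.
  have /esym/((lft_den_unitP _ _).1 td) p1 := lft_graph Gd E.
  move: E; rewrite p1 mulmx0 col_mx0 => /((lft_den_unitP _ _).1 Gd) p2.
  by rewrite [p]split_decomp p1 p2 !mulmx0 addr0.
split=> //; have [p /trans/(lft_graph Gd)/esym/(lft_graph td)] := lft_graph_ex 1%:M tu.
by rewrite !mulmx1.
Qed.

(** Since a = diag(t0, 1) and the rows of g are orthonormal, the rows of b
    that belong to the identity block vanish.  Hence the range of g restricted
    to the remaining inputs lies in the remaining outputs, which makes the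
    compression isometric; compressing commutes with closing the loop. *)
Lemma lft_compress r (g : 'M[C]_(n + r)) t0 : g \is unitarymx ->
  lft g 0 = extend_id E1 E2 t0 ->
  exists2 g' : 'M[C]_(n1 + r), g' \is unitarymx &
    forall t, lft g' t = E1 ^t* *m lft g t *m E1.
Proof.
move=> gu; rewrite /lft mulmx0 !mul0mx addr0 => aE.
have b0 : E2 ^t* *m ursubmx g = 0.
  have /unitarymxP := gu; rewrite -{1 2}[g]submxK adjmx_block mulmx_block.
  rewrite scalar_mx_block => /eq_block_mx [aa _ _ _].
  have : E2 ^t* *m (ulsubmx g *m ulsubmx g ^t* + ursubmx g *m ursubmx g ^t*) *m E2
    = 1%:M by rewrite aa mulmx1 e22.
  rewrite mulmxDr mulmxDl !mulmxA aE extend_id_snd -[X in X + _]mulmxA.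
  have -> : (extend_id E1 E2 t0) ^t* *m E2 = (E2 ^t* *m extend_id E1 E2 t0) ^t*.
    by rewrite adjmxM trmxCK.
  rewrite extend_id_snd trmxCK e22 -[RHS]addr0 => /addrI b0.
  rewrite -[LHS]trmxCK (_ : (_ *m _) ^t* = 0) ?adjmx0 //.
  by apply: gram_eq0; rewrite trmxCK adjmxM trmxCK mulmxA.
pose P : 'M[C]_(n + r, n1 + r) := block_mx E1 0 0 1%:M.
have PP : P ^t* *m P = 1%:M.
  rewrite adjmx_block mulmx_block !adjmx0 adjmx1 !(mul0mx, mulmx0, addr0, add0r).
  by rewrite e11 mul1mx -scalar_mx_block.
have Pg : P *m P ^t* *m (g *m P) = g *m P.
  have -> : g *m P = block_mx (ulsubmx g *m E1) (ursubmx g) (dlsubmx g *m E1) (drsubmx g).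
    rewrite -{1}[g]submxK mulmx_block.
    by rewrite !(mul0mx, mulmx0, addr0, add0r, mulmx1).
  rewrite adjmx_block mulmx_block !adjmx0 adjmx1 !(mul0mx, mulmx0, addr0, add0r).
  rewrite mul1mx mulmx_block !(mul0mx, mulmx0, addr0, add0r) !mul1mx.
  congr block_mx.
    rewrite mulmxA (_ : E1 *m E1 ^t* = 1%:M - E2 *m E2 ^t*); last first.
      by rewrite -eD addrK.
    rewrite !mulmxBl mul1mx -!mulmxA [E2 ^t* *m (_ *m _)]mulmxA aE extend_id_snd.
    by rewrite e21 mulmx0 subr0.
  rewrite (_ : E1 *m E1 ^t* = 1%:M - E2 *m E2 ^t*); last by rewrite -eD addrK.
  by rewrite mulmxBl mul1mx -mulmxA b0 mulmx0 subr0.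
exists (P ^t* *m (g *m P)).
  apply/unitary_isometry; rewrite adjmxM trmxCK -mulmxA [P *m _]mulmxA Pg.
  by rewrite gram_isometry // (unitary_isometry g).1.
move=> t; rewrite /lft.
have -> : P ^t* *m (g *m P) = block_mx (E1 ^t* *m ulsubmx g *m E1)
    (E1 ^t* *m ursubmx g) (dlsubmx g *m E1) (drsubmx g).
  rewrite -{1}[g]submxK !mulmx_block adjmx_block mulmx_block !adjmx0 adjmx1.
  by rewrite !(mul0mx, mulmx0, addr0, add0r, mulmx1, mul1mx) !mulmxA.
rewrite block_mxKul block_mxKur block_mxKdl block_mxKdr.
by rewrite mulmxDr mulmxDl !mulmxA.
Qed.

End Split.

(** * Amplification by an identity factor *)

Lemma castmx_extend_id n1 n2 n (e : (n1 + n2)%N = n) :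
  exists E1 E2, @orth_split n n1 n2 E1 E2 /\
    forall t, castmx (e, e) (block_mx t 0 0 1%:M) = extend_id E1 E2 t.
Proof.
case: _ / e; exists (col_mx 1%:M 0), (col_mx 0 1%:M).
rewrite /orth_split /extend_id !adjmx_col !adjmx0 !adjmx1; split.
  rewrite !mul_row_col !mul_col_row add_block_mx.
  rewrite !(mul0mx, mulmx0, addr0, add0r, mulmx1).
  by rewrite -scalar_mx_block.
move=> t; rewrite castmx_id mul_col_mx !mul_col_row add_block_mx.
by rewrite !(mul0mx, mulmx0, addr0, add0r, mulmx1, mul1mx).
Qed.

Section Ampliation.
Variable j : nat.

(** Rectangular version of [ampl], needed to amplify embeddings. *)
Definition amplify m n (A : 'M[C]_(m, n)) : 'M[C]_(m * j, n * j) := A *t 1%:M.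

Lemma amplifyM m n r (A : 'M[C]_(m, n)) (B : 'M[C]_(n, r)) :
  amplify (A *m B) = amplify A *m amplify B.
Proof. by rewrite /amplify tensmx_mul mulmx1. Qed.

Lemma amplifyD m n (A B : 'M[C]_(m, n)) : amplify (A + B) = amplify A + amplify B.
Proof. by apply/matrixP=> i k; rewrite !mxE mulrDl. Qed.

Lemma amplifyN m n (A : 'M[C]_(m, n)) : amplify (- A) = - amplify A.
Proof. by apply/matrixP=> i k; rewrite !mxE mulNr. Qed.

Lemma amplify0 m n : amplify (0 : 'M[C]_(m, n)) = 0.
Proof. exact: tens0mx. Qed.

Lemma amplify_id m : amplify (1%:M : 'M[C]_m) = 1%:M.
Proof.
apply/matrixP=> i k; case: (mxtens_indexP i) => a b.
case: (mxtens_indexP k) => c d; rewrite tensmxE !mxE.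
rewrite (can_eq (@mxtens_indexK _ _)) xpair_eqE -natrM mulnb //.
Qed.

Lemma amplify_adj m n (A : 'M[C]_(m, n)) : (amplify A) ^t* = amplify (A ^t*).
Proof. by rewrite /amplify trmx_tens map_mxT trmx1 map_mx1. Qed.

Lemma amplify_split n n1 n2 (E1 : 'M[C]_(n, n1)) (E2 : 'M[C]_(n, n2)) :
  orth_split E1 E2 -> orth_split (amplify E1) (amplify E2).
Proof.
case=> e11 e22 e12 eD; rewrite /orth_split !amplify_adj -!amplifyM -amplifyD.
by rewrite e11 e22 e12 eD !amplify_id amplify0.
Qed.

Lemma amplify_extend_id n n1 n2 (E1 : 'M[C]_(n, n1)) (E2 : 'M[C]_(n, n2)) t :
  amplify (extend_id E1 E2 t) = extend_id (amplify E1) (amplify E2) (amplify t).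
Proof. by rewrite /extend_id amplifyD !amplifyM !amplify_adj. Qed.

(** The amplification of t acts by t on each of the j slices of a column. *)
Definition slice m (v : 'cV[C]_(m * j)) (l : 'I_j) : 'cV[C]_m :=
  \col_i v (mxtens_index (i, l)) 0.

Lemma sqn_slice m (v : 'cV[C]_(m * j)) : sqn v = \sum_l sqn (slice v l).
Proof.
rewrite /sqn exchange_big pair_big /= (reindex (@mxtens_index m j)) /=.
  by apply: eq_bigr => -[i l] _; rewrite mxE.
by exists (@mxtens_unindex m j) => i _; rewrite (mxtens_indexK, mxtens_unindexK).
Qed.

Lemma slice_amplify m (t : 'M[C]_m) (v : 'cV[C]_(m * j)) l :
  slice (amplify t *m v) l = t *m slice v l.
Proof.
apply/colP=> i; rewrite !mxE (reindex (@mxtens_index m j)) /=; last first.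
  by exists (@mxtens_unindex m j) => k _; rewrite (mxtens_indexK, mxtens_unindexK).
transitivity (\sum_a \sum_b amplify t (mxtens_index (i, l))
    (mxtens_index (a, b)) * v (mxtens_index (a, b)) 0).
  by rewrite pair_big; apply: eq_bigr => -[a b].
apply: eq_bigr => a _; rewrite (bigD1 l) //= tensmxE !mxE eqxx mulr1.
by rewrite big1 ?addr0 // => b bl; rewrite tensmxE mxE eq_sym (negPf bl) mulr0 mul0r.
Qed.

(** No slice grows, and a nonzero column has a nonzero slice, which strictly
    shrinks. *)
Lemma amplify_strict_contraction m (t : 'M[C]_m) :
  strict_contraction t -> strict_contraction (amplify t).
Proof.
move=> ts v v0; rewrite lt_def !sqn_slice; apply/andP; split; last first.
  by apply: ler_sum => l _; rewrite slice_amplify; apply: strict_contractionW.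
apply: contraNneq v0 => E.
have /eqP : \sum_l (sqn (slice v l) - sqn (t *m slice v l)) = 0.
  apply/eqP; rewrite sumrB E subr_eq0; apply/eqP.
  by apply: eq_bigr => l _; rewrite slice_amplify.
rewrite psumr_eq0 => [/allP v0|l _]; last first.
  by rewrite subr_ge0; apply: strict_contractionW.
rewrite -sqn_eq0 sqn_slice big1 // => l _; apply/eqP; rewrite sqn_eq0.
apply/negPn/negP => /ts; rewrite -subr_gt0.
by have := v0 l (mem_index_enum _) => /= /eqP ->; rewrite ltxx.
Qed.

Definition amplify_blocks m (h : 'M[C]_(m + m)) : 'M[C]_(m * j + m * j) :=
  block_mx (amplify (ulsubmx h)) (amplify (ursubmx h))
           (amplify (dlsubmx h)) (amplify (drsubmx h)).

Lemma amplify_blocks_pseudo_unitary m (h : 'M[C]_(m + m)) :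
  pseudo_unitarymx h -> pseudo_unitarymx (amplify_blocks h).
Proof.
rewrite /pseudo_unitarymx /amplify_blocks /signature_mx -{1 2}[h]submxK.
rewrite !adjmx_block !mulmx_block.
rewrite !(mul0mx, mulmx0, addr0, add0r, mulmx1, mulmxN, mulNmx).
move=> /eq_block_mx [aa ac ca cc].
rewrite !amplify_adj -!amplifyM -!amplifyN -!amplifyD aa ac ca cc.
by rewrite amplifyN amplify_id amplify0.
Qed.

(** Amplification is a unital ring morphism, so it commutes with
    gamma[h; _]. *)
Lemma amplify_blocks_linfrac m (h : 'M[C]_(m + m)) z :
  ulsubmx h + z *m dlsubmx h \in unitmx ->
  ulsubmx (amplify_blocks h) + amplify z *m dlsubmx (amplify_blocks h) \in unitmx /\
  linfrac (amplify_blocks h) (amplify z) = amplify (linfrac h z).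
Proof.
move=> du; rewrite /linfrac /amplify_blocks.
rewrite block_mxKul block_mxKur block_mxKdl block_mxKdr -!amplifyM -!amplifyD.
set A := _ + _ in du *; set B := _ + _.
have /mulmx1_unit [Au _] : amplify A *m amplify (invmx A) = 1%:M.
  by rewrite -amplifyM mulmxV // amplify_id.
split=> //; apply: (canLR (mulKmx Au)); rewrite -amplifyM mulKVmx //.
Qed.

End Ampliation.

End HermitianAlgebra.

(** * The open matrix ball *)

Section MatrixBall.
Variable R : realType.
Implicit Types m n k j alpha : nat.

Lemma normr_normc (x : R[i]) : `|x| = (Normc.normc x)%:C.
Proof. by case: x. Qed.

Lemma sqn_vec_norm n (v : 'cV[R[i]]_n) : sqn v = ((vec_norm v) ^+ 2)%:C.
Proof.
rewrite /vec_norm sqr_sqrtr; last by apply: sumr_ge0 => i _; rewrite sqr_ge0.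
by rewrite /sqn rmorph_sum; apply: eq_bigr => i _; rewrite rmorphXn.
Qed.

Lemma vec_norm_ge0 n (v : 'cV[R[i]]_n) : 0 <= vec_norm v.
Proof. exact: sqrtr_ge0. Qed.

Lemma vec_normZ n (a : R[i]) (v : 'cV[R[i]]_n) :
  vec_norm (a *: v) = Normc.normc a * vec_norm v.
Proof.
rewrite /vec_norm -[Normc.normc a]ger0_norm; last first.
  by case: a => x y; apply: sqrtr_ge0.
rewrite -sqrtr_sqr -sqrtrM ?sqr_ge0 // mulr_sumr; congr Num.sqrt.
by apply: eq_bigr => i _; rewrite mxE Normc.normcM exprMn.
Qed.

Lemma normc_entry n (v : 'cV[R[i]]_n) i : Normc.normc (v i 0) <= vec_norm v.
Proof.
rewrite -[leLHS]ger0_norm -?sqrtr_sqr; last by case: (v i 0) => *; apply: sqrtr_ge0.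
apply: ler_wsqrtr; rewrite (bigD1 i) //= lerDl.
by apply: sumr_ge0 => *; apply: sqr_ge0.
Qed.

(** The operator norm is defined as a supremum, which is meaningful only for a
    nonempty bounded set; entrywise estimates give the bound. *)
Lemma has_sup_op_norm n (z : 'M[R[i]]_n) :
  has_sup [set vec_norm (z *m v) | v in [set v | vec_norm v <= 1]].
Proof.
split.
  exists (vec_norm (z *m 0)), 0 => //=.
  by rewrite -(scale0r 0) vec_normZ Normc.normc0 mul0r.
exists (Num.sqrt (\sum_i (\sum_k Normc.normc (z i k)) ^+ 2)) => _ [v v1 <-].
apply: ler_wsqrtr; apply: ler_sum => i _.
have nn (x : R[i]) : 0 <= Normc.normc x by case: x => *; apply: sqrtr_ge0.
rewrite ler_pXn2r ?nnegrE ?sumr_ge0 // -lecR rmorph_sum mxE.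
rewrite -normr_normc; apply: le_trans (ler_norm_sum _ _ _) _.
apply: ler_sum => k _; rewrite normrM !normr_normc ler_piMr ?lecR //.
exact: le_trans (normc_entry v k) v1.
Qed.

Lemma vec_norm_op_norm n (z : 'M[R[i]]_n) (v : 'cV[R[i]]_n) :
  vec_norm (z *m v) <= op_norm z * vec_norm v.
Proof.
have [v0|v0] := eqVneq (vec_norm v) 0.
  have -> : v = 0 by apply/eqP; rewrite -sqn_eq0 sqn_vec_norm v0 expr0n.
  by rewrite mulmx0 -(scale0r 0) vec_normZ Normc.normc0 mul0r mulr0.
have v_gt0 : 0 < vec_norm v by rewrite lt_def v0 vec_norm_ge0.
rewrite -ler_pdivrMr // mulrC.
have nV : Normc.normc ((vec_norm v)^-1)%:C = (vec_norm v)^-1.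
  by rewrite /= expr0n addr0 sqrtr_sqr ger0_norm // invr_ge0 ltW.
rewrite -{1}nV -vec_normZ scalemxAr; apply: ub_le_sup.
  by case: (has_sup_op_norm z).
by exists (((vec_norm v)^-1)%:C *: v) => //=; rewrite vec_normZ nV mulVf.
Qed.

Lemma mball_strict n (z : 'M[R[i]]_n) : mball z -> strict_contraction z.
Proof.
move=> z1 v v0; rewrite !sqn_vec_norm ltcR.
have v_gt0 : 0 < vec_norm v.
  rewrite lt_def vec_norm_ge0 andbT; apply: contra_neq v0 => v0.
  by apply/eqP; rewrite -sqn_eq0 sqn_vec_norm v0 expr0n.
rewrite ltr_pXn2r ?nnegrE ?vec_norm_ge0 //.
by apply: le_lt_trans (vec_norm_op_norm z v) _; rewrite gtr_pMl.
Qed.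

Lemma mball0 n : @mball R n 0.
Proof.
apply: le_lt_trans (ltr01); apply: sup_le_ub.
  by case: (has_sup_op_norm (0 : 'M[R[i]]_n)).
by move=> _ [v _ <-]; rewrite mul0mx -(scale0r 0) vec_normZ Normc.normc0 mul0r.
Qed.

(** * Characteristic functions and boundary components *)

Lemma theta_lft alpha m j (g : 'M[R[i]]_(alpha + m * j)) S :
  theta g S = lft g (amplify j S).
Proof. by []. Qed.

Lemma mball_den_unit alpha m j (g : 'M[R[i]]_(alpha + m * j)) S :
  g \is unitarymx -> mball S ->
  1%:M - drsubmx g *m amplify j S \in unitmx.
Proof.
move=> gu /mball_strict/(@amplify_strict_contraction _ j).
exact: lft_den_strict.
Qed.

(** Changing the external ports by h replaces the values gamma[h; diag(u, 1)]
    of F by diag(u, 1); the compression to the first block then has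
    characteristic function u. *)
Lemma Char_into_boundary_component m alpha (F : 'M[R[i]]_m -> 'M[R[i]]_alpha) Co :
  Char F -> (forall S, mball S -> Co (F S)) -> Char_o_into Co F.
Proof.
move=> [j [g [gu FE]]] FC k kn h [_ hJ CoE].
have [E1 [E2 [sE dE]]] := castmx_extend_id R[i] (subnK kn).
have [g' gu' g'E] := unitary_outer_port_change gu hJ.
have values S : mball S -> exists2 u, mball u &
    theta g S = iota_comp kn h u /\ theta g' S = extend_id E1 E2 u.
  move=> SB; have := FC S SB; rewrite CoE => -[u uB uE]; rewrite FE // in uE.
  exists u => //; split=> //.
  have zc := extend_id_contraction sE (strict_contractionW (mball_strict uB)).
  have du := linfrac_den_unit hJ zc.
  have zE : theta g S = linfrac h (extend_id E1 E2 u).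
    by rewrite -dE; exact: esym uE.
  have [p] := lft_graph_ex 1%:M (mball_den_unit gu' SB).
  rewrite -theta_lft mulmx1 => pE.
  (* Pull the input 1 and the output of the new system back to ports of g. *)
  have [y [x [yE xE]]] := ports_surj (theta g' S) 1%:M hJ.
  move: pE; rewrite -yE -xE => /g'E/(lft_graph (mball_den_unit gu SB)).
  by rewrite -theta_lft zE => /(linfrac_graph _ _ du) ->; rewrite xE mulmx1.
(* At the centre the value is the upper left block, as the compression needs. *)
have [u0 _ [_]] := values 0 (mball0 m).
rewrite theta_lft amplify0 => aE.
have [g2 g2u g2E] := lft_compress sE gu' aE.
have thE S u : theta g' S = extend_id E1 E2 u -> theta g2 S = u.
  rewrite !theta_lft g2E => ->; rewrite (extend_id_fst sE) -mulmxA.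
  by case: sE => -> *; rewrite mulmx1.
exists (theta g2); split; first split.
- by exists j, g2.
- by move=> S /values [u uB [_ /thE ->]].
by move=> S SB; have [u uB [gE /thE ->]] := values S SB; rewrite FE.
Qed.

(** Changing the feedback ports by the amplification of h turns the law
    q = gamma[h; diag(u, 1)] p into the law with matrix diag(u, 1), whose
    identity block is closed by [lft_extend_id]. *)
Lemma Char_restr_boundary_component m alpha j (g : 'M[R[i]]_(alpha + m * j)) Co :
  g \is unitarymx -> (exists S0, Co S0 /\ \det (theta_den g S0) != 0) ->
  forall k (kn : (k <= m)%N) h, comp_chart Co kn h ->
   (forall S, Co S -> \det (theta_den g S) != 0) /\
   Char (fun u : 'M[R[i]]_(m - k) => theta g (iota_comp kn h u)).
Proof.
move=> gu [S0 [CS0 S0u]] k kn h [_ hJ CoE].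
have [E1 [E2 [sE dE]]] := castmx_extend_id R[i] (subnK kn).
have [g' gu' g'E] := unitary_port_change gu (amplify_blocks_pseudo_unitary j hJ).
have aJ := amplify_blocks_pseudo_unitary j hJ.
have ioE u : iota_comp kn h u = linfrac h (extend_id E1 E2 u) by rewrite -dE.
pose d u := amplify j (extend_id E1 E2 u).
have graph u w (q p : 'M[R[i]]_(m * j, w)) : mball u ->
    q = amplify j (iota_comp kn h u) *m p <->
    port_fst (amplify_blocks j h) q p = d u *m port_snd (amplify_blocks j h) q p.
  move=> uB.
  have zc := extend_id_contraction sE (strict_contractionW (mball_strict uB)).
  have [du lE] := amplify_blocks_linfrac j (linfrac_den_unit hJ zc).
  by rewrite ioE -lE; exact: linfrac_graph.
have denE S : (\det (theta_den g S) != 0) =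
    (1%:M - drsubmx g *m amplify j S \in unitmx).
  by rewrite unitmxE unitfE.
(* A loop of g for the law gamma[h; diag(u, 1)] is a loop of g' for diag(u, 1). *)
have den u : mball u -> \det (theta_den g (iota_comp kn h u)) != 0 <->
    1%:M - drsubmx g' *m d u \in unitmx.
  move=> uB; rewrite denE.
  split=> /lft_den_unitP u0; apply/lft_den_unitP => y p E.
    have [q' [p' [qE pE]]] := ports_surj (d u *m p) p aJ.
    have q'E := (graph u _ q' p' uB).2; rewrite qE pE in q'E.
    move: E; rewrite -{2}pE -qE => /g'E; rewrite q'E // => /u0 p0.
    by rewrite -pE p0 q'E // p0 mulmx0 /port_snd !mulmx0 subrr.
  have /g'E := E; have pqE := (graph u _ _ p uB).1 erefl; rewrite pqE.
  move=> /u0 p0; rewrite p0 mulmx0 in pqE.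
  have [_ //] : amplify j (iota_comp kn h u) *m p = 0 /\ p = 0.
  by apply: (ports_inj aJ); rewrite ?pqE ?p0 /port_fst /port_snd !mulmx0 subrr.
have dd u : d u = extend_id (amplify j E1) (amplify j E2) (amplify j u).
  exact: amplify_extend_id.
have [u0 u0B u0E] : exists2 u, mball u & iota_comp kn h u = S0.
  by move: CS0; rewrite CoE.
have u0u := (den u0 u0B).1; rewrite u0E in u0u; have {}u0u := u0u S0u.
rewrite dd in u0u; have [g2 g2u g2E] := lft_extend_id (amplify_split j sE) gu' u0u.
have dall u : mball u -> \det (theta_den g (iota_comp kn h u)) != 0.
  move=> uB; apply: (den u uB).2; rewrite dd.
  by have [] := g2E _ (amplify_strict_contraction (j := j) (mball_strict uB)).
split; first by move=> S; rewrite CoE => -[u uB <-]; apply: dall.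
exists j, g2; split=> // u uB.
have [tu tE] := g2E _ (amplify_strict_contraction (j := j) (mball_strict uB)).
rewrite -dd in tE tu.
have tg : 1%:M - drsubmx g *m amplify j (iota_comp kn h u) \in unitmx.
  by rewrite -denE; apply: dall.
have [p /g'E] := lft_graph_ex 1%:M tg.
rewrite ((graph u _ _ p uB).1 erefl) => /(lft_graph tu).
by rewrite tE !mulmx1.
Qed.

End MatrixBall.

Theorem theorem1p9 (R : realType) (m alpha : nat)
    (m_gt0 : (0 < m)%N) (alpha_gt0 : (0 < alpha)%N) :
  (forall (F : 'M[R[i]]_m -> 'M[R[i]]_alpha) (Co : set 'M[R[i]]_alpha),
     Char F -> boundary_component Co ->
     (forall S, mball S -> Co (F S)) ->
     Char_o_into Co F)
  /\
  (forall (j : nat) (g : 'M[R[i]]_(alpha + m * j)) (Co : set 'M[R[i]]_m),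
     g \is unitarymx -> boundary_component Co ->
     (exists S0, Co S0 /\ \det (theta_den g S0) != 0) ->
     (forall S, Co S -> \det (theta_den g S) != 0) /\
     Char_restr Co (theta g)).
Proof.
split=> [F Co FC _|j g Co gu [k [kn [h hC]]] S0].
  exact: Char_into_boundary_component.
split; first by case: (Char_restr_boundary_component gu S0 hC).
by move=> k' kn' h' /(Char_restr_boundary_component gu S0) [].
Qed.
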